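(* Suppose $A\in\mathbb{R}^{m\times n}$ is full column-rank. Then $\overline{\chi}(A)\le\|A\|\cdot\chi(A)$, and $\overline{\chi}(A)=\chi(A)$ when the columns of $A$ are orthonormal. In particular, $$\overline{\chi}(A)=\min_{R\in\mathbb{R}^{n\times n}\text{ non-singular}}\|AR\|\cdot\chi(AR).$$
   Context: Here $m,n\ge 1$; $\mathbb{R}^d$ carries the Euclidean norm $\|\cdot\|$ and matrices carry the induced operator norm $\|M\|=\max_{\|x\|\le 1}\|Mx\|$. $\mathscr{D}:=\{\operatorname{Diag}(d): d\in\mathbb{R}^m_{++}\}$ is the set of $m\times m$ diagonal matrices with positive diagonal entries. For $A\in\mathbb{R}^{m\times n}$ of full column rank and $D\in\mathscr{D}$, let $A_D^\dagger:=(A^{\mathsf T}DA)^{-1}A^{\mathsf T}D$, and define $$\chi(A):=\sup_{D\in\mathscr{D}}\|A_D^\dagger\|,\qquad \overline{\chi}(A):=\sup_{D\in\mathscr{D}}\|AA_D^\dagger\|=\sup_{D\in\mathscr{D}}\|A(A^{\mathsf T}DA)^{-1}A^{\mathsf T}D\|,$$ both of which are known to be finite. *)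

(* Defs.v *)
From mathcomp Require Import all_boot all_order all_algebra.
From mathcomp Require Import all_classical all_reals all_analysis.

Set Implicit Arguments.
Unset Strict Implicit.
Unset Printing Implicit Defensive.

Import Order.TTheory GRing.Theory Num.Theory.
Local Open Scope classical_set_scope.
Local Open Scope ring_scope.

(* MathComp-Analysis norms matrices by the maximum of their entries, hence a
   separate Euclidean norm. *)
Definition enorm (R : realType) (d : nat) (x : 'cV[R]_d) : R :=
  Num.sqrt (\sum_(i < d) x i ord0 ^+ 2).

(* By compactness of the unit ball the supremum is a maximum. *)
Definition opnorm (R : realType) (p q : nat) (M : 'M[R]_(p, q)) : R :=
  sup [set enorm (M *m x) | x in [set x : 'cV[R]_q | enorm x <= 1]].

(* [sup] on [R] returns 0 outside of [has_sup]; that case does not arise. *)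
Lemma opnorm_has_sup (R : realType) (p q : nat) (M : 'M[R]_(p, q)) :
  has_sup [set enorm (M *m x) | x in [set x : 'cV[R]_q | enorm x <= 1]].
Proof.
split.
  exists (enorm (M *m 0)); exists 0 => //=.
  rewrite /enorm big1 ?sqrtr0 ?ler01// => i _.
  by rewrite mxE expr0n.
exists (Num.sqrt (\sum_(i < p) (\sum_(j < q) `|M i j|) ^+ 2)) => _ [x /= x1 <-].
rewrite /enorm ler_wsqrtr// ler_sum// => i _.
rewrite -[leLHS]real_normK ?num_real// ler_pXn2r ?nnegrE ?normr_ge0 ?sumr_ge0// mxE.
apply: (le_trans (ler_norm_sum _ _ _)); apply: ler_sum => j _.
rewrite normrM ler_piMr//; apply: le_trans x1.
rewrite -sqrtr_sqr ler_wsqrtr// (bigD1 j)//= lerDl sumr_ge0// => k _.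
exact: sqr_ge0.
Qed.

Definition posdiag (R : realType) (m : nat) : set 'M[R]_m :=
  [set diag_mx d | d in [set d : 'rV[R]_m | forall i, 0 < d ord0 i]].

(* [A^T *m D *m A] is invertible when [A] has full column rank and [D] is in
   [posdiag]; [invmx] is the identity on singular matrices. *)
Definition wpinv (R : realType) (m n : nat) (A : 'M[R]_(m, n)) (D : 'M[R]_m) :
    'M[R]_(n, m) :=
  invmx (A^T *m D *m A) *m A^T *m D.

(* The suprema are finite for every [A] of full column rank; taking them in
   [\bar R] avoids the default value that [sup] gives to unbounded sets. *)
Definition chi (R : realType) (m n : nat) (A : 'M[R]_(m, n)) : \bar R :=
  ereal_sup [set (opnorm (wpinv A D))%:E | D in @posdiag R m].

Definition chibar (R : realType) (m n : nat) (A : 'M[R]_(m, n)) : \bar R :=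
  ereal_sup [set (opnorm (A *m wpinv A D))%:E | D in @posdiag R m].

Definition orthonormal_cols (R : realType) (m n : nat) (A : 'M[R]_(m, n)) : Prop :=
  forall j k : 'I_n, \sum_(i < m) A i j * A i k = (j == k)%:R.

Definition is_minimum (R : realType) (S : set (\bar R)) (v : \bar R) : Prop :=
  S v /\ lbound S v.

(* Main.v *)
(* Right multiplication of [A] by a non-singular [P] turns [wpinv A D] into
   [P^-1 *m wpinv A D], so [chibar] depends only on the column space of [A] and
   the lower bound is the product inequality applied to [A *m P].  It is attained
   by any [P] making the columns of [A *m P] orthonormal: left multiplication by
   [A *m P] is then isometric, so that [chi] and [chibar] agree and the operator
   norm is 1. *)
Require Import Defs.
From mathcomp Require Import all_boot all_order all_algebra.
From mathcomp Require Import all_classical all_reals all_analysis.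

Set Implicit Arguments.
Unset Strict Implicit.
Unset Printing Implicit Defensive.

Import Order.TTheory GRing.Theory Num.Theory.
Local Open Scope classical_set_scope.
Local Open Scope ring_scope.

(** * Euclidean and operator norms *)

Lemma sqr_enorm (R : realType) (d : nat) (x : 'cV[R]_d) :
  enorm x ^+ 2 = (x^T *m x) ord0 ord0.
Proof.
rewrite /enorm sqr_sqrtr ?sumr_ge0// => [|i _]; last exact: sqr_ge0.
by rewrite mxE; apply: eq_bigr => i _; rewrite mxE expr2.
Qed.

Lemma enorm_ge0 (R : realType) (d : nat) (x : 'cV[R]_d) : 0 <= enorm x.
Proof. exact: sqrtr_ge0. Qed.

Lemma enormZ (R : realType) (d : nat) (c : R) (x : 'cV[R]_d) :
  enorm (c *: x) = `|c| * enorm x.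
Proof.
rewrite /enorm -sqrtr_sqr -sqrtrM ?sqr_ge0// mulr_sumr.
by congr Num.sqrt; apply: eq_bigr => i _; rewrite mxE exprMn.
Qed.

Lemma enorm_eq0 (R : realType) (d : nat) (x : 'cV[R]_d) :
  (enorm x == 0) = (x == 0).
Proof.
apply/idP/eqP => [/eqP x0|->]; last first.
  by rewrite -(scale0r (0 : 'cV[R]_d)) enormZ normr0 mul0r.
have /eqP : \sum_(i < d) x i ord0 ^+ 2 = 0.
  have := congr1 (fun r => r ^+ 2) x0.
  rewrite expr0n /enorm sqr_sqrtr// sumr_ge0// => i _; exact: sqr_ge0.
rewrite psumr_eq0 => [/allP h|i _]; last exact: sqr_ge0.
apply/matrixP => i j; rewrite (ord1 j) mxE; apply/eqP.
by have := h i (mem_index_enum i); rewrite /= sqrf_eq0.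
Qed.

(** By homogeneity it suffices to treat [x] scaled by [(enorm x)^-1], which lies in the unit ball;
    [x = 0] cannot be normalised and is treated apart. *)
Lemma enorm_mulmx_le (R : realType) (p q : nat) (M : 'M[R]_(p, q))
  (x : 'cV[R]_q) : enorm (M *m x) <= opnorm M * enorm x.
Proof.
have [->|x0] := eqVneq x 0.
  by rewrite mulmx0 (eqP (_ : enorm 0 == 0)) ?enorm_eq0//
    (eqP (_ : enorm 0 == 0)) ?enorm_eq0// mulr0.
have xgt0 : 0 < enorm x by rewrite lt_neqAle eq_sym enorm_eq0 x0 enorm_ge0.
have c0 : 0 <= (enorm x)^-1 by rewrite invr_ge0 ltW.
rewrite -ler_pdivrMr// mulrC -[X in X * _ <= _]ger0_norm// -enormZ scalemxAr.
apply: sup_upper_bound; first exact: opnorm_has_sup.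
by exists ((enorm x)^-1 *: x) => //=; rewrite enormZ ger0_norm// mulVf// gt_eqF.
Qed.

Lemma opnorm_le (R : realType) (p q : nat) (M : 'M[R]_(p, q)) (c : R) :
  (forall x : 'cV[R]_q, enorm x <= 1 -> enorm (M *m x) <= c) -> opnorm M <= c.
Proof.
move=> h; apply: ge_sup; first by have [] := opnorm_has_sup M.
by move=> _ [x /= x1 <-]; exact: h.
Qed.

Lemma opnorm_ge0 (R : realType) (p q : nat) (M : 'M[R]_(p, q)) : 0 <= opnorm M.
Proof.
apply: (le_trans (enorm_ge0 (M *m 0))).
apply: sup_upper_bound; first exact: opnorm_has_sup.
by exists 0 => //=; rewrite (eqP (_ : enorm 0 == 0)) ?enorm_eq0.
Qed.

Lemma opnormM_le (R : realType) (p q r : nat) (M : 'M[R]_(p, q))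
  (N : 'M[R]_(q, r)) : opnorm (M *m N) <= opnorm M * opnorm N.
Proof.
apply: opnorm_le => x x1; rewrite -mulmxA.
apply: (le_trans (enorm_mulmx_le _ _)); apply: ler_wpM2l; first exact: opnorm_ge0.
apply: (le_trans (enorm_mulmx_le _ _)).
by rewrite ler_piMr// opnorm_ge0.
Qed.

Lemma chibar_le (R : realType) (m n : nat) (A : 'M[R]_(m, n)) :
  (chibar A <= (opnorm A)%:E * chi A)%E.
Proof.
apply: ge_ereal_sup => _ [D hD <-].
apply: (@le_trans _ _ ((opnorm A)%:E * (opnorm (wpinv A D))%:E)%E).
  by rewrite -EFinM lee_fin opnormM_le.
apply: lee_wpmul2l; first by rewrite lee_fin opnorm_ge0.
by apply: ereal_sup_ubound; exists D.
Qed.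

(** * Matrices with orthonormal columns *)

Lemma orthonormal_colsP (R : realType) (m n : nat) (A : 'M[R]_(m, n)) :
  orthonormal_cols A <-> A^T *m A = 1%:M.
Proof.
split=> [h|h j k].
  apply/matrixP => j k; rewrite !mxE -h.
  by apply: eq_bigr => i _; rewrite mxE.
move/matrixP: h => /(_ j k); rewrite !mxE => <-.
by apply: eq_bigr => i _; rewrite mxE.
Qed.

Lemma enorm_orthonormal (R : realType) (m n : nat) (A : 'M[R]_(m, n))
  (x : 'cV[R]_n) : orthonormal_cols A -> enorm (A *m x) = enorm x.
Proof.
move/orthonormal_colsP => h; apply/eqP.
rewrite -(@eqrXn2 _ 2)// ?enorm_ge0// !sqr_enorm.
by rewrite trmx_mul mulmxA -(mulmxA x^T) h mulmx1.
Qed.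

Lemma opnorm_orthonormal (R : realType) (m n p : nat) (A : 'M[R]_(m, n))
  (M : 'M[R]_(n, p)) : orthonormal_cols A -> opnorm (A *m M) = opnorm M.
Proof.
move=> h; rewrite /opnorm; congr (sup (image _ _)).
by apply/funext => x; rewrite -mulmxA enorm_orthonormal.
Qed.

(** A unit vector exists only in positive dimension: for [n = 0] the norm would be 0. *)
Lemma opnorm1 (R : realType) (n : nat) : (1 <= n)%N ->
  opnorm (1%:M : 'M[R]_n) = 1.
Proof.
move=> n0; apply/eqP; rewrite eq_le; apply/andP; split.
  by apply: opnorm_le => x; rewrite mul1mx.
have e1 : enorm (delta_mx (Ordinal n0) ord0 : 'cV[R]_n) = 1.
  apply/eqP; rewrite -(@eqrXn2 _ 2)// ?enorm_ge0// sqr_enorm trmx_delta.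
  by rewrite mul_delta_mx mxE !eqxx expr1n.
by have := enorm_mulmx_le 1%:M (delta_mx (Ordinal n0) ord0 : 'cV[R]_n);
  rewrite mul1mx e1 mulr1.
Qed.

Lemma chibar_orthonormal (R : realType) (m n : nat) (A : 'M[R]_(m, n)) :
  orthonormal_cols A -> chibar A = chi A.
Proof.
move=> h; rewrite /chibar /chi; congr (ereal_sup (image _ _)).
by apply/funext => D; rewrite opnorm_orthonormal.
Qed.

(** * Positive definite matrices up to congruence *)

Definition posdef (R : realType) (n : nat) (S : 'M[R]_n) : Prop :=
  forall x : 'cV[R]_n, x != 0 -> 0 < (x^T *m S *m x) ord0 ord0.

Lemma mulmx_full_col_rank_eq0 (R : fieldType) (m n : nat) (A : 'M[R]_(m, n))
  (x : 'cV[R]_n) : \rank A = n -> (A *m x == 0) = (x == 0).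
Proof.
move=> hA; apply/eqP/eqP => [h|->]; last by rewrite mulmx0.
apply: trmx_inj; rewrite trmx0.
have fA : row_free A^T by rewrite /row_free mxrank_tr hA.
by apply: (row_free_inj fA); rewrite -trmx_mul h mul0mx trmx0.
Qed.

(** The quadratic form of [S] would vanish at any nonzero kernel vector. *)
Lemma posdef_unit (R : realType) (n : nat) (S : 'M[R]_n) :
  posdef S -> S \in unitmx.
Proof.
move=> h; rewrite -unitmx_tr -row_free_unit -kermx_eq0.
apply/contraT => /rowV0Pn[v /sub_kermxP vS v0].
have : v^T != 0 by rewrite -(trmx0 R 1 n) (inj_eq trmx_inj).
move/h; rewrite -mulmxA.
suff -> : S *m v^T = 0 by rewrite mulmx0 mxE ltxx.
by apply: trmx_inj; rewrite trmx_mul trmxK vS trmx0.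
Qed.

(** Full column rank makes [P] injective, so the substitution of [P *m x] for [x] preserves nonzero
    vectors. *)
Lemma posdef_congr (R : realType) (m n : nat) (S : 'M[R]_m) (P : 'M[R]_(m, n)) :
  \rank P = n -> posdef S -> posdef (P^T *m S *m P).
Proof.
move=> hP hS x x0.
have /hS : P *m x != 0 by rewrite mulmx_full_col_rank_eq0.
by rewrite trmx_mul !mulmxA.
Qed.

Lemma posdef_posdiag (R : realType) (m : nat) (D : 'M[R]_m) :
  posdiag D -> posdef D.
Proof.
move=> [d /= d0 <-] x x0.
have -> : (x^T *m diag_mx d *m x) ord0 ord0 = \sum_i d ord0 i * x i ord0 ^+ 2.
  rewrite mxE; apply: eq_bigr => i _.
  by rewrite mul_mx_diag !mxE expr2 mulrA (mulrC (x i ord0)).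
have pos i : true -> 0 <= d ord0 i * x i ord0 ^+ 2.
  by rewrite mulr_ge0 ?sqr_ge0// ltW.
rewrite lt_neqAle sumr_ge0// andbT eq_sym; apply: contra x0.
rewrite psumr_eq0// => /allP h; apply/eqP/matrixP => i j.
rewrite (ord1 j) mxE; apply/eqP.
by have := h i (mem_index_enum i); rewrite /= mulf_eq0 gt_eqF//= sqrf_eq0.
Qed.

Lemma posdef1 (R : realType) (n : nat) : posdef (1%:M : 'M[R]_n).
Proof.
by apply: posdef_posdiag; exists (const_mx 1) => [i|];
  rewrite ?mxE// diag_const_mx.
Qed.

(** This makes the [invmx] inside [wpinv] a genuine inverse. *)
Lemma gram_unit (R : realType) (m n : nat) (A : 'M[R]_(m, n)) (D : 'M[R]_m) :
  \rank A = n -> posdiag D -> A^T *m D *m A \in unitmx.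
Proof.
by move=> hA hD; apply/posdef_unit/posdef_congr => //; exact: posdef_posdiag.
Qed.

(* Induction on the size through the Schur complement of the top left entry. *)
Lemma exists_posdef_congr1 (R : realType) (n : nat) (S : 'M[R]_n) :
  S^T = S -> posdef S -> exists P : 'M[R]_n, P^T *m S *m P = 1%:M.
Proof.
elim: n S => [|n IH] S symS hS.
  by exists 1%:M; apply/matrixP => -[].
(* The same matrix, with its size displayed as a sum so that it splits into blocks. *)
pose S' : 'M[R]_(1 + n) := S.
pose a := S ord0 ord0; pose b := ursubmx S'; pose C := drsubmx S'.
have SE : S' = block_mx a%:M b b^T C.
  rewrite -[LHS]submxK; congr block_mx.
    apply/matrixP => i j; rewrite !ord1 !mxE eqxx mulr1n /a.
    by congr (S _ _); apply/val_inj.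
  by rewrite /b trmx_ursub; congr dlsubmx; exact/esym.
(* [a] is the value of the quadratic form at the first basis vector. *)
have a0 : 0 < a.
  have e0 : (delta_mx ord0 ord0 : 'cV[R]_n.+1) != 0.
    apply/eqP => /matrixP /(_ ord0 ord0); rewrite !mxE !eqxx => /eqP.
    by rewrite oner_eq0.
  by have := hS _ e0; rewrite trmx_delta -rowE -colE !mxE.
(* One step of symmetric Gaussian elimination: congruence by [L] clears the off-diagonal blocks and
   leaves the Schur complement [T]. *)
pose L : 'M[R]_(1 + n) := block_mx 1%:M (- a^-1 *: b) 0 1%:M.
pose T := C - a^-1 *: (b^T *m b).
have LSL : L^T *m S' *m L = block_mx a%:M 0 0 T.
  have bT : (- a^-1 *: b)^T = - a^-1 *: b^T by apply/matrixP => i j; rewrite !mxE.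
  rewrite SE /L tr_block_mx !mulmx_block !trmx1 !trmx0 bT.
  rewrite !(mul1mx, mul0mx, mulmx0, mulmx1, addr0, add0r).
  rewrite mul_scalar_mx mul_mx_scalar !scalerA mulrN mulfV ?gt_eqF//.
  rewrite !scaleN1r !addNr mul0mx add0r -scalemxAl scaleNr.
  by congr block_mx; rewrite /T addrC.
have Lunit : L \in unitmx.
  by rewrite unitmxE /L det_ublock !det1 mulr1 unitr1.
have pLSL : posdef (L^T *m S' *m L).
  by apply: posdef_congr => //; exact: mxrank_unit.
(* The form of [T] is that of the block diagonal matrix on vectors with first coordinate 0. *)
have pT : posdef T.
  move=> x x0; have y0 : col_mx (0 : 'cV_1) x != 0.
    by rewrite col_mx_eq0 eqxx.
  have := pLSL _ y0; rewrite LSL tr_col_mx mul_row_block mul_row_col.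
  by rewrite !trmx0 !(mul0mx, mulmx0, addr0, add0r).
have symT : T^T = T.
  rewrite /T linearB linearZ /= trmx_mul trmxK; congr (_ - _).
  by rewrite /C trmx_drsub; congr (drsubmx _).
have [Q hQ] := IH _ symT pT.
(* [K] normalises the two diagonal blocks separately: [a] by its square root, [T] by the inductive
   [Q]. *)
pose K : 'M[R]_(1 + n) := block_mx ((Num.sqrt a)^-1)%:M 0 0 Q.
have sa : Num.sqrt a != 0 by rewrite gt_eqF// sqrtr_gt0.
have aK : (Num.sqrt a)^-1 * a * (Num.sqrt a)^-1 = 1.
  by rewrite -[X in _ * X * _](sqr_sqrtr (ltW a0)) expr2 mulKf// mulfV.
have KTK : K^T *m block_mx a%:M 0 0 T *m K = 1%:M.
  rewrite /K tr_block_mx !mulmx_block tr_scalar_mx !trmx0.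
  rewrite !(mul0mx, mulmx0, addr0, add0r) hQ -!scalar_mxM aK.
  by rewrite -scalar_mx_block.
exists (L *m K : 'M[R]_(1 + n)).
by rewrite -[RHS]KTK -LSL trmx_mul !mulmxA.
Qed.

(** * Orthonormalization and change of basis *)

Lemma orthonormalization (R : realType) (m n : nat) (A : 'M[R]_(m, n)) :
  \rank A = n -> exists2 P : 'M[R]_n, P \in unitmx & orthonormal_cols (A *m P).
Proof.
(* Orthonormality of the columns of [A *m P] says that [P] reduces the Gram matrix of [A] to the
   identity by congruence. The factor [1%:M] gives that matrix the shape expected by
   [posdef_congr]. *)
move=> hA; have [||P hP] := @exists_posdef_congr1 R n (A^T *m 1%:M *m A).
- by rewrite mulmx1 trmx_mul trmxK.
- by apply: posdef_congr => //; exact: posdef1.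
(* A square factor of the identity is invertible. *)
exists P; first by have [] := mulmx1_unit hP.
by apply/orthonormal_colsP; rewrite -hP mulmx1 trmx_mul !mulmxA.
Qed.

Lemma wpinv_mulmx (R : realType) (m n : nat) (A : 'M[R]_(m, n)) (P : 'M[R]_n)
  (D : 'M[R]_m) : \rank A = n -> P \in unitmx -> posdiag D ->
  wpinv (A *m P) D = invmx P *m wpinv A D.
Proof.
move=> hA hP hD; have G := gram_unit hA hD.
have uPt : P^T \in unitmx by rewrite unitmx_tr.
have H : P^T *m (A^T *m D *m A) *m P \in unitmx by rewrite !unitmx_mul uPt G hP.
have -> : wpinv (A *m P) D =
    invmx (P^T *m (A^T *m D *m A) *m P) *m (P^T *m (A^T *m D)).
  by rewrite /wpinv trmx_mul !mulmxA.
(* Rather than inverting the triple product, multiply the claimed value by it and cancel [P] and the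
   Gram matrix of [A] in turn. *)
rewrite -[RHS](mulKmx H); congr (_ *m _).
by rewrite -(mulmxA _ P) mulKVmx// /wpinv -(mulmxA P^T) -(mulmxA (invmx _)) mulKVmx.
Qed.

Lemma chibar_mulmx (R : realType) (m n : nat) (A : 'M[R]_(m, n)) (P : 'M[R]_n) :
  \rank A = n -> P \in unitmx -> chibar (A *m P) = chibar A.
Proof.
move=> hA hP; rewrite /chibar; congr ereal_sup; apply: eq_imagel => D hD.
by rewrite wpinv_mulmx// -mulmxA (mulmxA P) mulmxV// mul1mx.
Qed.

Theorem proposition1 (R : realType) (m n : nat) (hm : (1 <= m)%N) (hn : (1 <= n)%N)
    (A : 'M[R]_(m, n)) (hA : \rank A = n) :
  [/\ (chibar A <= (opnorm A)%:E * chi A)%E,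
      orthonormal_cols A -> chibar A = chi A
    & is_minimum
        [set ((opnorm (A *m P))%:E * chi (A *m P))%E | P in [set P : 'M[R]_n | P \in unitmx]]
        (chibar A)].
Proof.
split; [exact: chibar_le | exact: chibar_orthonormal | split].
  have [P hP oP] := orthonormalization hA.
  exists P => //.
  (* The second factor becomes [chibar A]. Writing [A *m P] as a product with the identity reduces
     its norm to that of [1%:M], which is 1 because [n] is positive. *)
  rewrite -chibar_orthonormal// chibar_mulmx// -[A *m P]mulmx1.
  by rewrite opnorm_orthonormal// opnorm1// mul1e.
by move=> _ [P /= hP <-]; rewrite -(chibar_mulmx hA hP) chibar_le.
Qed.
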